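(* Let $z \in \mathbb{R}^2$. (1) The cone location depth (cone distribution function) algorithm described in the context, applied to $z$, terminates after a finite number of rotation steps. (2) If $\tilde X_0$ denotes the original data set, $N$ the number of points of $\tilde X = \tilde X_0 \cup \{z\}$, and $K$ the final number produced by the algorithm, then $$F_{\tilde X_0, C}(z) = \begin{cases} \dfrac{K}{N} & \text{if } z \text{ is an original data point, i.e. } z \in \tilde X_0,\\[2mm] \dfrac{K-1}{N-1} & \text{if } z \text{ is not an original data point, i.e. } z \notin \tilde X_0.\end{cases}$$
   Context: $\tilde X_0 \subseteq \mathbb{R}^2$ is a finite nonempty set of (pairwise distinct) data points. The closed convex cone $C \subseteq \mathbb{R}^2$ is generated by two linearly independent vectors, $C = \{s_1 b^1 + s_2 b^2 \mid s_1, s_2 \geq 0\}$; its dual cone $C^+ = \{w \in \mathbb{R}^2 \mid w^\top y \geq 0 \text{ for all } y \in C\}$ is generated by two linearly independent vectors $v^1, v^2$, and $B^+ = \{(1-s)v^1 + s v^2 \mid s \in [0,1]\}$ is a base of $C^+$. For $w \in \mathbb{R}^2\setminus\{0\}$, $H^+(w) = \{y \in \mathbb{R}^2 \mid w^\top y \geq 0\}$. $\#$ denotes cardinality. The empirical lower $C$-distribution function of a finite nonempty data set $\tilde Y \subseteq \mathbb{R}^2$ is $F_{\tilde Y, C}(z) = \frac{1}{\#\tilde Y}\min_{w \in B^+} \#\{x \in \tilde Y \mid x \in z - H^+(w)\}$. The point $z$ is added to the data set if necessary: $\tilde X = \tilde X_0 \cup \{z\} = \{x^1, \ldots, x^N\}$,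 $N = \#\tilde X$. For $w \in B^+$ put $w\text{-}depth(z;\tilde X) = \#\{x \in \tilde X \mid x \in z - H^+(w)\}$ and $X^=(w,z) = \{x \in \tilde X \mid w^\top x = w^\top z\}$. Rotation step with input $w \in B^+ \setminus\{v^2\}$: let $k = \#\{x \in \tilde X \mid w^\top x < w^\top z\}$; list the points of $X^=(w,z)$ in increasing order of $(v^2)^\top x$ and let $\ell$ be the position of $z$ in this list; put $\kappa(w) = k + \ell$. Choose a permutation $\pi_w$ of $\{1,\ldots,N\}$ with $w^\top x^{\pi_w(1)} \leq \ldots \leq w^\top x^{\pi_w(N)}$ in which the points of $X^=(w,z)$ are listed in increasing order of $(v^2)^\top x$; thus $x^{\pi_w(\kappa(w))} = z$. For $s \in [0,1]$ set $w(s) = (1-s)w + s v^2$, and let $\bar s$ be the maximal $s \in [0,1]$ subject to $w(s)^\top x^{\pi_w(j)} \leq w(s)^\top z$ for $j = 1, \ldots, \kappa(w)-1$ and $w(s)^\top x^{\pi_w(j)} \geq w(s)^\top z$ for $j = \kappa(w)+1, \ldots, N$. The output is $w(\bar s)$. Algorithm. Step 1: set $n := 1$, $w^1 := v^1$, $K := \kappa(w^1)$. Step 2: until $w^n = v^2$, repeat: perform the rotation step with input $w^n$, call the output $w^{n+1}$; if $w^{n+1} \neq v^2$, update $K := \min\{K, \kappa(w^{n+1})\}$; update $n := n+1$. Step 3: when $w^n = v^2$, update $K := \min\{K, v^2\text{-}depth(z;\tilde X)\}$. The final value of $K$ is the output. *)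

(* Defs.v *)
From HB Require Import structures.
From mathcomp Require Import all_boot all_order all_algebra finmap.
From mathcomp Require Import boolp classical_sets reals.

Set Implicit Arguments.
Unset Strict Implicit.
Unset Printing Implicit Defensive.

Import Order.TTheory GRing.Theory Num.Theory.
Local Open Scope fset_scope.
Local Open Scope classical_set_scope.
Local Open Scope ring_scope.

Definition dotp (R : realType) (w x : 'cV[R]_2) : R := (w^T *m x) 0 0.

Definition cone2 (R : realType) (b1 b2 : 'cV[R]_2) : set 'cV[R]_2 :=
  [set y | exists s1 s2 : R,
    [/\ 0 <= s1, 0 <= s2 & y = s1 *: b1 + s2 *: b2]].

Definition dual_cone (R : realType) (C : set 'cV[R]_2) : set 'cV[R]_2 :=
  [set w | forall y, C y -> 0 <= dotp w y].

Definition segpt (R : realType) (u v : 'cV[R]_2) (s : R) : 'cV[R]_2 :=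
  (1 - s) *: u + s *: v.

Definition Bplus (R : realType) (v1 v2 : 'cV[R]_2) : set 'cV[R]_2 :=
  [set segpt v1 v2 s | s in [set s : R | 0 <= s <= 1]].

Definition Hplus (R : realType) (w : 'cV[R]_2) : set 'cV[R]_2 :=
  [set y | 0 <= dotp w y].

Definition wdepth (R : realType) (Y : {fset 'cV[R]_2}) (z w : 'cV[R]_2) : nat :=
  #|` [fset x in Y | x \in [set z - y | y in Hplus w]] |.

Lemma wdepth_Bplus_ex (R : realType) (v1 v2 : 'cV[R]_2) (Y : {fset 'cV[R]_2})
    (z : 'cV[R]_2) :
  exists m, `[< exists2 w, Bplus v1 v2 w & wdepth Y z w = m >].
Proof.
exists (wdepth Y z v1); apply/asboolP; exists v1 => //.
by exists 0; rewrite /= ?lexx ?ler01 // /segpt subr0 scale1r scale0r addr0.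
Qed.

(* The cone C enters only through the base [Bplus v1 v2] of its dual cone. *)
Definition lower_cone_df (R : realType) (v1 v2 : 'cV[R]_2)
    (Y : {fset 'cV[R]_2}) (z : 'cV[R]_2) : R :=
  (ex_minn (wdepth_Bplus_ex v1 v2 Y z))%:R / #|` Y|%:R.

Definition Xeq (R : realType) (X : {fset 'cV[R]_2}) (z w : 'cV[R]_2) :
    {fset 'cV[R]_2} :=
  [fset x in X | dotp w x == dotp w z].

Definition le_dotp (R : realType) (w : 'cV[R]_2) : rel 'cV[R]_2 :=
  fun x y => dotp w x <= dotp w y.

(* [index] counts from 0, positions in the list count from 1. *)
Definition kappa (R : realType) (v2 : 'cV[R]_2) (X : {fset 'cV[R]_2})
    (z w : 'cV[R]_2) : nat :=
  (#|` [fset x in X | (dotp w x < dotp w z)%R] |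
   + (index z (sort (le_dotp v2) (Xeq X z w))).+1)%N.

(* A permutation pi_w of the indices is represented by the permuted list
   xs = x^{pi_w(1)}, ..., x^{pi_w(N)} of the points of X. *)
Definition rotation_order (R : realType) (v2 : 'cV[R]_2)
    (X : {fset 'cV[R]_2}) (z w : 'cV[R]_2) (xs : seq 'cV[R]_2) : Prop :=
  [/\ perm_eq xs X,
      sorted (le_dotp w) xs &
      sorted (le_dotp v2) [seq x <- xs | x \in Xeq X z w]].

(* Indices j count from 1, hence [nth 0 xs j.-1]. *)
Definition rotation_feasible (R : realType) (v2 : 'cV[R]_2)
    (X : {fset 'cV[R]_2}) (z w : 'cV[R]_2) (xs : seq 'cV[R]_2) (s : R) : Prop :=
  [/\ 0 <= s <= 1,
      forall j : nat, (1 <= j <= (kappa v2 X z w).-1)%N ->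
        dotp (segpt w v2 s) (nth 0 xs j.-1) <= dotp (segpt w v2 s) z &
      forall j : nat, ((kappa v2 X z w).+1 <= j <= #|` X|)%N ->
        dotp (segpt w v2 s) (nth 0 xs j.-1) >= dotp (segpt w v2 s) z].

(* A relation, since the order of the points is chosen freely among the
   admissible ones. *)
Definition rotation (R : realType) (v2 : 'cV[R]_2) (X : {fset 'cV[R]_2})
    (z w w' : 'cV[R]_2) : Prop :=
  exists (xs : seq 'cV[R]_2) (sbar : R),
    [/\ rotation_order v2 X z w xs,
        rotation_feasible v2 X z w xs sbar,
        (forall s, rotation_feasible v2 X z w xs s -> s <= sbar) &
        w' = segpt w v2 sbar].

(* [reachable v1 v2 X z n w K]: some run of the algorithm has current values
   n, w^n = w and K. *)
Inductive reachable (R : realType) (v1 v2 : 'cV[R]_2) (X : {fset 'cV[R]_2})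
    (z : 'cV[R]_2) : nat -> 'cV[R]_2 -> nat -> Prop :=
| reachable_start : reachable v1 v2 X z 1 v1 (kappa v2 X z v1)
| reachable_rotate n w K w' :
    reachable v1 v2 X z n w K -> w <> v2 -> rotation v2 X z w w' ->
    reachable v1 v2 X z n.+1 w'
      (if w' == v2 then K else minn K (kappa v2 X z w')).

Definition output (R : realType) (v1 v2 : 'cV[R]_2) (X : {fset 'cV[R]_2})
    (z : 'cV[R]_2) (K : nat) : Prop :=
  exists n K', reachable v1 v2 X z n v2 K' /\ K = minn K' (wdepth X z v2).

(* Every rotation step that is called for can be carried out (in particular the
   maximal s exists), and the number of rotation steps of a run is bounded; so
   every run ends, and it does so at w^n = v2. *)
Definition terminates (R : realType) (v1 v2 : 'cV[R]_2) (X : {fset 'cV[R]_2})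
    (z : 'cV[R]_2) : Prop :=
  (forall n w K, reachable v1 v2 X z n w K -> w <> v2 ->
     exists w', rotation v2 X z w w') /\
  (exists M : nat, forall n w K, reachable v1 v2 X z n w K -> (n <= M)%N).

(* Main.v *)
Require Import Defs.
From mathcomp Require Import all_boot all_order all_algebra finmap.
From mathcomp Require Import boolp classical_sets reals.
From mathcomp Require Import ring lra.

Set Implicit Arguments.
Unset Strict Implicit.
Unset Printing Implicit Defensive.

Import Order.TTheory GRing.Theory Num.Theory.
Local Open Scope fset_scope.
Local Open Scope classical_set_scope.
Local Open Scope ring_scope.

(** Each data point [x] contributes an affine function of the parameter of the
    segment from [v1] to [v2], its height above the line through [z] orthogonal
    to the current direction.  The depth at a direction counts the points of
    nonpositive height, so it is constant between consecutive zeros of these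
    functions, and at a zero it is at least as large as just after it.  Hence
    the minimum over the whole segment is reached either at [v2] or on one of
    the open intervals between zeros.

    The number [kappa v2 X z w] is exactly the depth immediately after [w]: the
    points before [z] are those of negative height together with those of
    height zero whose height is about to become negative, i.e. is negative at
    [v2] ([kappaE]).  This uses that no point other than [z] stays on the line
    during the rotation ([generic]), which holds since [v1] and [v2] are
    linearly independent.  A rotation step is feasible exactly as long as no
    point changes the sign of its height ([rotation_feasibleP]), so it ends at
    the first crossing, or at [v2].  In between, the depth equals [kappa]
    ([wdepth_between]), and it is nowhere smaller before the end of the step
    ([kappa_le_wdepth]).  The successive steps sweep the whole segment, so the
    output is the minimal depth ([output_min]).

    Termination: if a step stops before [v2], then some point reaches height
    zero whose heights at the start and at [v2] have opposite signs.  An affine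
    function changes sign at most once, so the number of sign changes still to
    come decreases strictly ([crossings_decr]).

    Finally, [z] has height zero for every direction, so adding it to data that
    do not contain it raises all depths by one ([wdepth_fset1U]). *)

(** * Sequences and finite sets *)

Lemma card_fset_filter (K : choiceType) (A : {fset K}) (P : pred K) :
  #|` [fset x in A | P x]| = count P A.
Proof.
rewrite -size_filter; apply/perm_size/uniq_perm.
- exact: fset_uniq.
- exact/filter_uniq/fset_uniq.
- by move=> x; rewrite !inE mem_filter andbC.
Qed.

Lemma sorted_split (T : eqType) (r : rel T) (s1 s2 : seq T) (z : T) :
  transitive r -> sorted r (s1 ++ z :: s2) ->
  {in s1, forall x, r x z} /\ {in s2, forall x, r z x}.
Proof.
move=> rtr; rewrite (sorted_pairwise rtr) pairwise_cat /=.
case/and3P => /allrelP s1z _ /andP[/allP zs2 _].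
by split => x xs; [apply: s1z; rewrite ?mem_head | exact: zs2].
Qed.

Lemma count_split (T : eqType) (P : pred T) (s1 s2 : seq T) (z : T) :
  {in s1, forall x, P x} -> ~~ P z -> {in s2, forall x, ~~ P x} ->
  count P (s1 ++ z :: s2) = size s1.
Proof.
move=> s1P /negPf zP s2P; rewrite count_cat /= zP.
have /eqP -> : count P s1 == size s1 by rewrite -all_count; apply/allP.
suff -> : count P s2 = 0%N by rewrite !addn0.
by apply/eqP; rewrite -leqn0 leqNgt -has_count; apply/hasPn.
Qed.

Lemma count_predU1 (T : eqType) (P : pred T) (s : seq T) (z : T) :
  uniq s -> z \in s -> ~~ P z -> count (predU1 z P) s = (count P s).+1.
Proof.
move=> us zs /negPf zP; have := count_predUI (pred1 z) P s.
rewrite count_uniq_mem // zs add1n => <-.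
rewrite [X in (_ + X)%N](_ : _ = 0%N) ?addn0 //.
rewrite (eq_count (a2 := pred0)) ?count_pred0 // => x /=.
by have [->|//] := eqVneq.
Qed.

Lemma sub_count_in (T : eqType) (P Q : pred T) (s : seq T) :
  {in s, forall x, P x -> Q x} -> (count P s <= count Q s)%N.
Proof.
elim: s => //= x s IH PQ; apply: leq_add.
  by case: (P x) (PQ x (mem_head _ _)) => // ->.
by apply: IH => y ys; apply: PQ; rewrite inE ys orbT.
Qed.

(** * Heights above the line through the query point *)

Section Height.
Variable R : realType.
Implicit Types (v w x y z : 'cV[R]_2) (s t : R).

Lemma dotpE w x : dotp w x = w 0 0 * x 0 0 + w 1 0 * x 1 0.
Proof.
rewrite /dotp mxE big_ord_recl big_ord1 !mxE.
by congr (_ + w _ _ * x _ _); apply/val_inj.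
Qed.

Definition height z w x : R := dotp w (x - z).

Lemma heightE z w x : height z w x = dotp w x - dotp w z.
Proof. by rewrite /height !dotpE !mxE; ring. Qed.

Lemma height_self z w : height z w z = 0.
Proof. by rewrite heightE subrr. Qed.

Lemma height_segpt z w v s x :
  height z (segpt w v s) x = (1 - s) * height z w x + s * height z v x.
Proof. by rewrite /height !dotpE !mxE; ring. Qed.

Lemma segpt0 w v : segpt w v 0 = w.
Proof. by rewrite /segpt subr0 scale1r scale0r addr0. Qed.

Lemma segpt1 w v : segpt w v 1 = v.
Proof. by rewrite /segpt subrr scale0r scale1r add0r. Qed.

Lemma segpt_segpt v1 v2 t s :
  segpt (segpt v1 v2 t) v2 s = segpt v1 v2 (t + s * (1 - t)).
Proof. by apply/matrixP => i j; rewrite !mxE; ring. Qed.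

Lemma segpt_param_bounds t s :
  0 <= t <= 1 -> 0 <= s <= 1 -> 0 <= t + s * (1 - t) <= 1.
Proof.
move=> /andP[t0 t1] /andP[s0 s1].
have : 0 <= s * (1 - t) by rewrite mulr_ge0 // subr_ge0.
have : 0 <= (1 - s) * (1 - t) by rewrite mulr_ge0 // subr_ge0.
by lra.
Qed.

Lemma segpt_eq_end w v s : w <> v -> segpt w v s = v -> s = 1.
Proof.
move=> wv e; have : (1 - s) *: (w - v) = 0.
  by rewrite -[RHS](subrr v) -{2}e; apply/matrixP => i j; rewrite !mxE; ring.
move/eqP; rewrite scaler_eq0 !subr_eq0 => /orP[/eqP-> //|/eqP].
by move=> /wv.
Qed.

Lemma wdepthE (Y : {fset 'cV[R]_2}) z w :
  wdepth Y z w = count (fun x => height z w x <= 0) Y.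
Proof.
rewrite /wdepth card_fset_filter; apply: eq_count => x /=.
apply/idP/idP; rewrite heightE.
  rewrite inE /= => -[y]; rewrite /Hplus /= => wy <-.
  by move: wy; rewrite !dotpE !mxE; lra.
move=> h; rewrite inE /=; exists (z - x); last by rewrite opprB addrC subrK.
by move: h; rewrite /Hplus /= !dotpE !mxE; lra.
Qed.

(** During a rotation from [w] to [v], a point lying on the rotating line
    through the origin at both ends would lie on it throughout; genericity of
    [w] excludes this for all nonzero points. *)
Definition generic v w := forall y, dotp w y = 0 -> dotp v y = 0 -> y = 0.

(** The two equations on [y] form a linear system whose determinant [d]
    vanishes only if [v1] is a multiple of [v2]. *)
Lemma free_generic v1 v2 : free [:: v1; v2] -> generic v2 v1.
Proof.
rewrite free_cons seq1_free span_seq1 => /andP[v1v2 v2N0] y.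
pose d := v1 0 0 * v2 1 0 - v1 1 0 * v2 0 0.
have ord2 (i : 'I_2) : i = 0 \/ i = 1.
  by case: i => [[|[|//]] ?]; [left|right]; apply/val_inj.
have dN0 : d != 0.
  apply: contra v1v2 => /eqP d0; apply/vlineP.
  have [v20|v20] := eqVneq (v2 0 0) 0.
    have v21 : v2 1 0 != 0.
      apply: contra v2N0 => /eqP v21; apply/eqP/matrixP => i j.
      by rewrite (ord1 j) mxE; case: (ord2 i) => ->.
    exists (v1 1 0 / v2 1 0); apply/matrixP => i j.
    rewrite (ord1 j) mxE; case: (ord2 i) => ->; last by rewrite divfK.
    apply: (mulIf v21); rewrite v20 mulr0 mul0r.
    by move: d0; rewrite /d v20; lra.
  exists (v1 0 0 / v2 0 0); apply/matrixP => i j.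
  rewrite (ord1 j) mxE; case: (ord2 i) => ->; first by rewrite divfK.
  apply: (mulIf v20); rewrite mulrAC divfK //.
  by move: d0; rewrite /d; lra.
rewrite !dotpE => e1 e2; apply/matrixP => i j; rewrite (ord1 j) mxE.
apply: (mulfI dN0); rewrite mulr0 /d.
case: (ord2 i) => ->.
  transitivity (v2 1 0 * (v1 0 0 * y 0 0 + v1 1 0 * y 1 0)
                - v1 1 0 * (v2 0 0 * y 0 0 + v2 1 0 * y 1 0)); first by ring.
  by rewrite e1 e2; ring.
transitivity (v1 0 0 * (v2 0 0 * y 0 0 + v2 1 0 * y 1 0)
              - v2 0 0 * (v1 0 0 * y 0 0 + v1 1 0 * y 1 0)); first by ring.
by rewrite e1 e2; ring.
Qed.

Lemma generic_segpt v w s : s < 1 -> generic v w -> generic v (segpt w v s).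
Proof.
move=> s1 gw y; have := height_segpt 0 w v s y; rewrite /height subr0 => ->.
move=> e vy; apply: gw => //; move: e; rewrite vy mulr0 addr0 => /eqP.
by rewrite mulf_eq0 => /orP[/eqP|/eqP //]; lra.
Qed.

Lemma generic_height v w z x :
  generic v w -> height z w x = 0 -> height z v x = 0 -> x = z.
Proof. by move=> gw w0 v0; apply/eqP; rewrite -subr_eq0; apply/eqP/gw. Qed.

Lemma le_dotp_trans w : transitive (le_dotp w).
Proof. by move=> y x t; apply: le_trans. Qed.

Lemma le_dotp_total w : total (le_dotp w).
Proof. by move=> x y; apply: le_total. Qed.

End Height.

(** * The rank of the query point *)

Section Rank.
Variables (R : realType) (v2 z : 'cV[R]_2) (X : {fset 'cV[R]_2}).
Hypothesis zX : z \in X.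
Implicit Types (w x : 'cV[R]_2) (s u : R) (xs : seq 'cV[R]_2).

Notation h := (height z).

(** The points that come before [z] in a rotation order; equivalently, those
    strictly below the line just after the rotation leaves [w]. *)
Definition precedes w : pred 'cV[R]_2 :=
  fun x => (h w x < 0) || (h w x == 0) && (h v2 x < 0).

Lemma precedes_self w : precedes w z = false.
Proof. by rewrite /precedes !height_self ltxx andbF. Qed.

Lemma mem_Xeq w x : (x \in Xeq X z w) = (x \in X) && (h w x == 0).
Proof. by rewrite /Xeq !inE heightE subr_eq0. Qed.

(** By genericity the points of [Xeq X z w] other than [z] have nonzero height
    at [v2], so sorting by [v2] puts in front of [z] exactly those of negative
    height. *)
Lemma kappaE w : generic v2 w -> kappa v2 X z w = (count (precedes w) X).+1.
Proof.
move=> gw; rewrite /kappa addnS; congr _.+1.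
rewrite card_fset_filter.
set ys := sort _ _.
have ysE x : (x \in ys) = (x \in X) && (h w x == 0).
  by rewrite mem_sort -mem_Xeq.
have ysu : uniq ys by rewrite sort_uniq fset_uniq.
have ysP : perm_eq ys (filter (fun x => h w x == 0) X).
  apply: uniq_perm => //; first exact/filter_uniq/fset_uniq.
  by move=> x; rewrite ysE mem_filter andbC.
have -> : index z ys = count (fun x => h v2 x < 0) ys.
  have : z \in ys by rewrite ysE zX height_self eqxx.
  have : sorted (le_dotp v2) ys by apply: sort_sorted; exact: le_dotp_total.
  move: ysu ysE; clearbody ys => + + + zys; clear ysP.
  case/splitPr: zys => s1 s2.
  rewrite cat_uniq /= negb_or => /and4P[_ /andP[zs1 _] _ _] ysE.
  case/sorted_split => [|s1z zs2]; first exact: le_dotp_trans.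
  rewrite index_cat (negPf zs1) /= eqxx addn0 count_split //.
  - move=> x xs1; rewrite lt_neqAle heightE subr_le0.
    have := s1z _ xs1; rewrite /le_dotp => ->; rewrite andbT.
    apply: contra zs1 => /eqP v0.
    have : x \in s1 ++ z :: s2 by rewrite mem_cat xs1.
    rewrite ysE => /andP[_ /eqP w0].
    by rewrite -(generic_height (z := z) (x := x) gw) // heightE.
  - by rewrite height_self ltxx.
  - by move=> x xs2; rewrite -leNgt heightE subr_ge0; apply: zs2.
rewrite (permP ysP) count_filter -count_predUI.
rewrite [X in (_ + X)%N](_ : _ = 0%N) ?addn0; last first.
  rewrite (eq_count (a2 := pred0)) ?count_pred0 // => x /=.
  by rewrite -subr_lt0 -heightE; case: ltgtP => //=; rewrite andbF.
apply: eq_count => x /=; rewrite /precedes -subr_lt0 -heightE.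
by rewrite (andbC (h v2 x < 0)).
Qed.

(** A rotation order may list points of equal height in any order away from
    [z], but the two sets of points before and after [z] are determined. *)
Lemma rotation_order_split w xs : generic v2 w -> rotation_order v2 X z w xs ->
  exists s1 s2 : seq _, [/\ xs = s1 ++ z :: s2, size s1 = (kappa v2 X z w).-1,
    {in s1, forall x, precedes w x} & {in s2, forall x, ~~ precedes w x}].
Proof.
move=> gw [xsX sw sv]; rewrite kappaE //= -(permP xsX).
have : uniq xs by rewrite (perm_uniq xsX) fset_uniq.
have xsXE := perm_mem xsX.
have : z \in xs by rewrite xsXE.
move=> zxs; move: sw sv xsXE; case/splitPr: xs / zxs {xsX} => s1 s2 sw sv xsXE.
rewrite cat_uniq /= negb_or => /and4P[_ /andP[zs1 _] zs2 _].
exists s1, s2.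
have [s1w s2w] := sorted_split (@le_dotp_trans _ _) sw.
move: sv; rewrite filter_cat /= mem_Xeq zX height_self eqxx /=.
case/sorted_split => [|s1v s2v]; first exact: le_dotp_trans.
have inX x : x \in s1 ++ z :: s2 -> x \in X by rewrite xsXE.
have s1P : {in s1, forall x, precedes w x}.
  move=> x xs1; rewrite /precedes.
  have := s1w _ xs1; rewrite /le_dotp -subr_le0 -heightE.
  rewrite le_eqVlt => /orP[/eqP w0|->//]; rewrite w0 eqxx ltxx /= lt_neqAle.
  have := s1v x; rewrite mem_filter xs1 mem_Xeq w0 eqxx inX ?mem_cat ?xs1 //.
  rewrite /le_dotp -subr_le0 -heightE => -> //; rewrite andbT.
  by apply: contra zs1 => /eqP v0; rewrite -(generic_height gw w0 v0).
have s2P : {in s2, forall x, ~~ precedes w x}.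
  move=> x xs2; rewrite /precedes negb_or negb_and -!leNgt.
  have := s2w _ xs2; rewrite /le_dotp -subr_ge0 -heightE => -> /=.
  have [w0|//] := eqVneq; rewrite /=.
  have := s2v x; rewrite mem_filter xs2 mem_Xeq w0 eqxx inX.
    by rewrite /le_dotp -subr_ge0 -heightE; apply.
  by rewrite mem_cat inE xs2 !orbT.
by split=> //; rewrite count_split // precedes_self.
Qed.

(** Merge sort is stable: sorting by [v2] first and by [w] next leaves the ties
    of [w] sorted by [v2]. *)
Lemma rotation_order_exists w : exists xs, rotation_order v2 X z w xs.
Proof.
exists (sort (le_dotp w) (sort (le_dotp v2) X)); split.
- by rewrite !perm_sort.
- exact/sort_sorted/le_dotp_total.
- rewrite filter_sort; [|exact: le_dotp_total|exact: le_dotp_trans].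
  rewrite sorted_sort; first last.
  + rewrite (sorted_pairwise (@le_dotp_trans _ _)).
    apply/(pairwiseP z) => i j; rewrite !inE => li lj _.
    have /allP a := filter_all (mem (Xeq X z w)) (sort (le_dotp v2) X).
    have := a _ (mem_nth z li); have := a _ (mem_nth z lj).
    rewrite !inE /le_dotp => /andP[_ /eqP j0] /andP[_ /eqP i0].
    by rewrite i0 j0.
  + exact: le_dotp_trans.
  apply: sorted_filter; first exact: le_dotp_trans.
  exact/sort_sorted/le_dotp_total.
Qed.

(** * Rotation up to the first crossing *)

(** A nonnegative product of the two heights also allows a point to start on
    the line, where it is free to leave on either side; that is the side
    predicted by [precedes]. *)
Definition no_crossing w s := {in X, forall x, 0 <= h w x * h (segpt w v2 s) x}.

(** Feasibility refers to a list that is chosen freely; this makes it a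
    condition on the set of points, so that the step is deterministic. *)
Lemma rotation_feasibleP w xs s :
  generic v2 w -> rotation_order v2 X z w xs ->
  rotation_feasible v2 X z w xs s <-> (0 <= s <= 1 /\ no_crossing w s).
Proof.
move=> gw o; have [s1 [s2 [xsE ks s1P s2P]]] := rotation_order_split gw o.
have xsXE : perm_eq xs X by case: o.
have sz : #|` X| = (size s1 + (size s2).+1)%N.
  by rewrite -(perm_size xsXE) xsE size_cat.
have kE : kappa v2 X z w = (size s1).+1 by rewrite ks kappaE.
have inX x : (x \in X) = [|| x \in s1, x == z | x \in s2].
  by rewrite -(perm_mem xsXE) xsE mem_cat inE.
rewrite /rotation_feasible kE /= sz.
split=> [[s01 le ge]|[s01 nc]]; split=> //.
- move=> x; rewrite inX => /or3P[xs1|/eqP->|xs2].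
  + have : h (segpt w v2 s) x <= 0.
      rewrite heightE subr_le0; have := le (index x s1).+1.
      by rewrite /= index_mem xs1 xsE nth_cat index_mem xs1 nth_index //; apply.
    by have /orP[?|/andP[/eqP->]] := s1P _ xs1; nra.
  + by rewrite height_self mul0r.
  + have : 0 <= h (segpt w v2 s) x.
      rewrite heightE subr_ge0; have := ge (size s1 + (index x s2).+2)%N.
      rewrite !addnS !ltnS leq_addr /= ltn_add2l index_mem xs2 xsE.
      rewrite nth_cat ltnNge -addnS leq_addr addKn /= nth_index //.
      exact.
    by have := s2P _ xs2; rewrite /precedes negb_or -leNgt => /andP[] *; nra.
- move=> [//|j] /= js; rewrite xsE nth_cat js -subr_le0 -heightE.
  set x := nth _ _ _; have xs1 : x \in s1 by apply: mem_nth.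
  have := nc x; rewrite inX xs1 height_segpt => /(_ isT).
  by have /orP[?|/andP[/eqP-> ?]] := s1P _ xs1; nra.
- move=> [//|j] /=; rewrite addnS !ltnS => /andP[sj js].
  rewrite xsE nth_cat ltnNge ltnW //= -subr_ge0 -heightE.
  have -> : (j - size s1)%N = (j - size s1).-1.+1 by rewrite prednK // subn_gt0.
  set x := nth _ _ _; have xs2 : x \in s2.
    by apply: mem_nth; rewrite prednK ?subn_gt0 // leq_subLR.
  have := nc x; rewrite inX xs2 !orbT height_segpt => /(_ isT).
  have := s2P _ xs2; rewrite /precedes negb_or -leNgt => /andP[].
  have [-> _|hN0 h0 _] := eqVneq (h w x) 0.
    by rewrite /= -leNgt => *; nra.
  have {hN0 h0} : 0 < h w x by rewrite lt_neqAle eq_sym hN0.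
  by move=> hp; rewrite pmulr_rge0.
Qed.

(** The maximal feasible parameter, characterized by the reason why the step
    stops there rather than by maximality. *)
Definition first_crossing w s :=
  [/\ 0 < s <= 1, no_crossing w s &
      s = 1 \/ exists x, [/\ x \in X, h w x * h v2 x < 0 &
                             h (segpt w v2 s) x = 0]].

(** A pair [p] stands for the affine function with values [p.1] at 0 and [p.2]
    at 1.  The parameter is the least of 1 and the zeros of the finitely many
    functions that change sign; it is positive because a function vanishing at
    0 is not among these. *)
Lemma affine_first_zero (ps : seq (R * R)) :
  let q (s : R) (p : R * R) := (1 - s) * p.1 + s * p.2 in
  exists s, [/\ 0 < s <= 1, {in ps, forall p, 0 <= p.1 * q s p} &
    s = 1 \/ exists p, [/\ p \in ps, p.1 * p.2 < 0 & q s p = 0]].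
Proof.
move=> q; elim: ps => [|[a b] ps [s [/andP[s0 s1] sok sfirst]]].
  by exists 1; split; [rewrite ltr01 lexx | | left].
have [abs|abs] := leP 0 (a * q s (a, b)).
  exists s; split; first by rewrite s0 s1.
    by move=> p; rewrite inE => /orP[/eqP->|/sok].
  case: sfirst => [->|[p [pps p0 qp]]]; [by left|right].
  by exists p; rewrite inE pps orbT.
move: abs; rewrite /q /= => abs.
have ab : a * b < 0 by nra.
have dN0 : a - b != 0 by apply/eqP => e; have : a = b by [lra]; nra.
(* The zero of the affine function with values a at 0 and b at 1. *)
pose m := a / (a - b).
have mE : m * (a - b) = a by rewrite /m divfK.
have d2 : 0 < a * (a - b) by nra.
have m0 : 0 < m.
  have : 0 < (a * (a - b)) / (a - b) ^+ 2.
    by rewrite divr_gt0 // exprn_even_gt0.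
  by rewrite expr2 invfM mulrA mulfK.
have ms : m < s.
  have : (s - m) * (a * (a - b)) = - (a * ((1 - s) * a + s * b)).
    by rewrite mulrBl [m * _]mulrCA mE; ring.
  by move=> e; rewrite -subr_gt0 -(pmulr_lgt0 _ d2) e oppr_gt0.
exists m; split; first by lra.
  move=> p; rewrite inE => /orP[/eqP->|/sok].
    by rewrite /q /= (_ : _ + m * b = a - m * (a - b)); [rewrite mE subrr mulr0 | ring].
  rewrite /q => ok.
  (* Before s no earlier function changes sign: its value at m lies between
     those at 0 and at s. *)
  have : 0 <= s * (p.1 * ((1 - m) * p.1 + m * p.2)).
    have -> : s * (p.1 * ((1 - m) * p.1 + m * p.2)) =
      (s - m) * (p.1 * p.1) + m * (p.1 * ((1 - s) * p.1 + s * p.2)) by ring.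
    by apply: addr_ge0; apply: mulr_ge0; rewrite ?subr_ge0 ?(ltW m0) ?(ltW ms) // -expr2 sqr_ge0.
  by rewrite pmulr_rge0.
right; exists (a, b); split; rewrite ?mem_head //.
by rewrite /q /= (_ : _ + m * b = a - m * (a - b)); [rewrite mE subrr | ring].
Qed.

Lemma first_crossing_exists w : exists s, first_crossing w s.
Proof.
have [s [s01 ok fst]] := affine_first_zero [seq (h w x, h v2 x) | x <- X].
exists s; split=> //.
  by move=> x xX; rewrite height_segpt; apply: (ok (_, _)); exact: map_f.
case: fst => [|[p [/mapP[x xX ->] ]]]; first by left.
by move=> ab q0; right; exists x; rewrite height_segpt.
Qed.

(** Beyond the zero of a blocking point its height keeps the wrong sign. *)
Lemma first_crossing_max w m s : first_crossing w m ->
  s <= 1 -> no_crossing w s -> s <= m.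
Proof.
case=> _ _ [-> //|[x [xX ab m0]]] s1 /(_ _ xX) sx.
rewrite leNgt; apply/negP => ms; move: m0 sx; rewrite !height_segpt => m0 sx.
set a := h w x in ab m0 sx; set b := h v2 x in ab m0 sx.
have : a * ((1 - s) * a + s * b) =
   a * ((1 - m) * a + m * b) + (s - m) * (a * b - a * a) by ring.
rewrite m0 mulr0 add0r => e; have d : a * b - a * a < 0 by nra.
by move: sx; rewrite e pmulr_rge0 ?subr_gt0 // leNgt d.
Qed.

Lemma rotation_first_crossing w w' : generic v2 w -> rotation v2 X z w w' ->
  exists2 s, first_crossing w s & w' = segpt w v2 s.
Proof.
move=> gw [xs [sb [o f sup ->]]]; have [m mP] := first_crossing_exists w.
exists m => //; congr segpt; apply/le_anti/andP; split.
  have [/andP[_ s1] nc] := (rotation_feasibleP sb gw o).1 f.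
  exact: first_crossing_max mP s1 nc.
apply: sup; apply/(rotation_feasibleP _ gw o).
by case: mP => /andP[/ltW -> ->].
Qed.

Lemma rotation_exists w : generic v2 w -> exists w', rotation v2 X z w w'.
Proof.
move=> gw; have [xs o] := rotation_order_exists w.
have [m mP] := first_crossing_exists w; exists (segpt w v2 m), xs, m; split=> //.
  apply/(rotation_feasibleP _ gw o).
  by case: mP => /andP[/ltW -> ->].
move=> s /(rotation_feasibleP _ gw o) [/andP[_ s1] nc].
exact: first_crossing_max mP s1 nc.
Qed.

(** * Depths met during one rotation step *)

(** A point below the line at both ends of the step is below it throughout;
    at [u = 0] and at [u = m] additional points may lie on the line, so only an
    inequality holds there. *)
Lemma kappa_le_wdepth w m u : generic v2 w -> first_crossing w m ->
  0 <= u <= m -> (kappa v2 X z w <= wdepth X z (segpt w v2 u))%N.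
Proof.
move=> gw [/andP[m0 m1] nc _] /andP[u0 um]; rewrite kappaE // wdepthE.
rewrite -(@count_predU1 _ _ _ z) ?fset_uniq ?precedes_self //.
apply: sub_count_in => x xX /=.
case/orP => [/eqP->|]; first by rewrite height_self.
move: (nc _ xX); rewrite !height_segpt => ncx.
case/orP => [hx|/andP[/eqP -> ?]]; last by nra.
have {}ncx : (1 - m) * h w x + m * h v2 x <= 0 by nra.
have [->|u0'] := eqVneq u 0; first by lra.
(* u lies between 0 and m, hence so does the height between its end values. *)
rewrite -(pmulr_rle0 _ m0).
have -> : m * ((1 - u) * h w x + u * h v2 x) =
  (m - u) * h w x + u * ((1 - m) * h w x + m * h v2 x) by ring.
by nra.
Qed.

(** Strictly inside the step the points on the initial line have left it, and
    those above it have not yet come down. *)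
Lemma wdepth_between w m u : generic v2 w -> first_crossing w m ->
  0 < u < m -> wdepth X z (segpt w v2 u) = kappa v2 X z w.
Proof.
move=> gw fm /andP[u0 um]; apply/eqP; rewrite eqn_leq.
rewrite (kappa_le_wdepth gw fm) ?ltW // andbT kappaE // wdepthE.
case: fm => [/andP[m0 m1] nc _].
rewrite -(@count_predU1 _ _ _ z) ?fset_uniq ?precedes_self //.
apply: sub_count_in => x xX /=; move: (nc _ xX); rewrite !height_segpt => ncx.
move=> hu; have [//|xz /=] := eqVneq x z.
rewrite /precedes; case: ltgtP => //= hx.
  move: ncx; rewrite pmulr_rge0 // => ncx.
  have : m * ((1 - u) * h w x + u * h v2 x) =
    (m - u) * h w x + u * ((1 - m) * h w x + m * h v2 x) by ring.
  have : 0 < (m - u) * h w x by rewrite mulr_gt0 ?subr_gt0.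
  have : 0 <= u * ((1 - m) * h w x + m * h v2 x) by rewrite mulr_ge0 ?(ltW u0).
  have : m * ((1 - u) * h w x + u * h v2 x) <= 0 by rewrite pmulr_rle0.
  by lra.
move: hu; rewrite hx mulr0 add0r pmulr_rle0 // le_eqVlt => /orP[/eqP v0|//].
by case/eqP: xz; apply: generic_height gw hx v0.
Qed.

(** * Runs of the algorithm *)

(** The points whose height has still to change sign strictly between [w] and
    [v2]. *)
Definition crossings w := count (fun x => h w x * h v2 x < 0) X.

(** A sign change still ahead after the step was also ahead before it, by
    affinity, and the blocking point is no longer counted. *)
Lemma crossings_decr w m : first_crossing w m -> m < 1 ->
  (crossings (segpt w v2 m) < crossings w)%N.
Proof.
move=> [/andP[m0 _] _ fst] m1; case: fst => [e|[y [yX y0 hy]]].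
  by rewrite e ltxx in m1.
rewrite /crossings -(@count_predU1 _ _ _ y) ?fset_uniq ?hy ?mul0r ?ltxx //.
apply: sub_count_in => x xX /= /orP[/eqP->//|].
rewrite height_segpt; set a := h w x; set b := h v2 x.
rewrite !ltNge; apply: contra => ab.
have -> : ((1 - m) * a + m * b) * b = (1 - m) * (a * b) + m * (b * b) by ring.
apply: addr_ge0; apply: mulr_ge0; rewrite ?subr_ge0 ?(ltW m0) ?(ltW m1) //.
by rewrite -expr2 sqr_ge0.
Qed.

Variable v1 : 'cV[R]_2.
Hypothesis v1_generic : generic v2 v1.

Lemma reachable_generic n w K :
  reachable v1 v2 X z n w K -> w <> v2 -> generic v2 w.
Proof.
elim=> // {}n {}w {}K w' _ IH wv2 rot w'v2.
have [s [/andP[_]]] := rotation_first_crossing (IH wv2) rot.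
rewrite le_eqVlt => /orP[/eqP-> _ _ w'E|s1 _ _ ->].
  by case: w'v2; rewrite w'E segpt1.
exact/generic_segpt/IH.
Qed.

(** The potential 0 at [v2], against [crossings w + 1] elsewhere, accounts for
    the last step, which need not meet any crossing. *)
Lemma reachable_bound n w K : reachable v1 v2 X z n w K ->
  (n + (if w == v2 then 0 else (crossings w).+1) <= (crossings v1).+2)%N.
Proof.
elim=> [|{}n {}w {}K w' r IH wv2 rot].
  by case: ifP.
have [s fc w'E] := rotation_first_crossing (reachable_generic r wv2) rot.
move: IH; have /eqP/negPf -> := wv2; move=> IH; apply: leq_trans IH.
rewrite addSnnS leq_add2l; case: (eqVneq w' v2) => // w'v2.
rewrite ltnS w'E crossings_decr //.
case: fc => /andP[_]; rewrite le_eqVlt => /orP[/eqP s1|//].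
by case/eqP: w'v2; rewrite w'E s1 segpt1.
Qed.

(** The value is a depth in the middle of the step that starts at [w], not in
    general the depth at [w] itself. *)
Lemma kappa_attained w t : generic v2 w -> w = segpt v1 v2 t -> 0 <= t <= 1 ->
  exists2 w0, Bplus v1 v2 w0 & wdepth X z w0 = kappa v2 X z w.
Proof.
move=> gw wE t01; have [m fm] := first_crossing_exists w.
have m01 : 0 < m <= 1 by case: fm.
exists (segpt w v2 (m / 2)).
  rewrite wE segpt_segpt; exists (t + m / 2 * (1 - t)) => //=.
  by apply: segpt_param_bounds => //; clear wE; lra.
by apply: (wdepth_between gw fm); clear wE; lra.
Qed.

(** The loop invariant: the part of the segment before the current direction
    is accounted for by [K], and the current direction itself only through the
    bound by [kappa], which passes to the next stretch of the segment. *)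
Lemma reachable_swept n w K : reachable v1 v2 X z n w K ->
  exists t, [/\ 0 <= t <= 1, w = segpt v1 v2 t,
    w <> v2 -> (K <= kappa v2 X z w)%N,
    forall u, 0 <= u < t -> (K <= wdepth X z (segpt v1 v2 u))%N &
    exists2 w0, Bplus v1 v2 w0 & wdepth X z w0 = K].
Proof.
elim=> [|{}n {}w {}K w' r [t [t01 wE Kk swept att]] wv2 rot].
  exists 0; split; rewrite ?lexx ?ler01 ?segpt0 //.
    by move=> u /andP[u0 /(le_lt_trans u0)]; rewrite ltxx.
  by apply: (@kappa_attained v1 0); rewrite ?segpt0 ?lexx ?ler01.
have gw := reachable_generic r wv2; have r' := reachable_rotate r wv2 rot.
have [s fc w'E] := rotation_first_crossing gw rot.
have /andP[s0 s1] : 0 < s <= 1 by case: fc.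
have t'01 : 0 <= t + s * (1 - t) <= 1.
  by apply: segpt_param_bounds; rewrite ?(ltW s0).
case/andP: t01 => t0; rewrite le_eqVlt => /orP[/eqP t1|t1].
  by case: wv2; rewrite wE t1 segpt1.
have w'E1 : w' = segpt v1 v2 (t + s * (1 - t)) by rewrite w'E wE segpt_segpt.
exists (t + s * (1 - t)); split=> //.
- by case: eqP => // _ _; rewrite geq_minr.
- move=> u /andP[u0 ut']; apply: (@leq_trans K); first by case: ifP; rewrite ?geq_minl.
  have [ut|tu] := ltP u t; first by apply: swept; rewrite u0.
  have t1' : 0 < 1 - t by rewrite subr_gt0.
  have uE : u = t + (u - t) / (1 - t) * (1 - t) by rewrite divfK ?gt_eqF //; ring.
  rewrite uE -segpt_segpt -wE; apply: (leq_trans (Kk wv2)).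
  apply: (kappa_le_wdepth gw fc).
  by rewrite divr_ge0 ?subr_ge0 ?(ltW t1) //= ler_pdivrMr // lerBlDl ltW.
- case: eqP => // w'v2; rewrite /minn; case: ifP => // _.
  exact: kappa_attained (reachable_generic r' w'v2) w'E1 t'01.
Qed.

Lemma output_min K : v1 <> v2 -> output v1 v2 X z K ->
  (exists2 w, Bplus v1 v2 w & wdepth X z w = K) /\
  (forall w, Bplus v1 v2 w -> (K <= wdepth X z w)%N).
Proof.
move=> v12 [n [K' [r ->]]]; have [t [t01 v2E _ swept att]] := reachable_swept r.
have t1 : t = 1 by apply: (@segpt_eq_end _ v1 v2).
split.
  rewrite /minn; case: ifP => // _; exists v2 => //.
  by exists 1; rewrite /= ?ler01 ?lexx ?segpt1.
move=> w [u /andP[u0]]; rewrite le_eqVlt => /orP[/eqP-> <-|u1 <-].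
  by rewrite segpt1 geq_minr.
by apply: leq_trans (geq_minl _ _) (swept _ _); rewrite u0 t1.
Qed.

Lemma algorithm_terminates : terminates v1 v2 X z.
Proof.
split=> [n w K r wv2|]; first exact/rotation_exists/(reachable_generic r).
exists (crossings v1).+2 => n w K /reachable_bound.
exact/leq_trans/leq_addr.
Qed.

End Rank.

(** * Adding the query point to the data *)

Lemma wdepth_fset1U (R : realType) (Y : {fset 'cV[R]_2}) (z w : 'cV[R]_2) :
  wdepth (z |` Y)%fset z w = (wdepth Y z w + (z \notin Y))%N.
Proof.
have [zY|zY] := boolP (z \in Y).
  by rewrite addn0; congr wdepth; apply/fsetUidPr; rewrite fsub1set.
rewrite !wdepthE.
have /permP -> : perm_eq (z |` Y)%fset (z :: Y).
  apply: uniq_perm; rewrite /= ?fset_uniq ?zY // => x.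
  by rewrite !inE.
by rewrite /= height_self lexx addnC.
Qed.

Theorem corollary4p10 (R : realType) (b1 b2 v1 v2 : 'cV[R]_2)
  (hb : free [:: b1; b2])
  (hv : free [:: v1; v2])
  (hdual : dual_cone (cone2 b1 b2) = cone2 v1 v2)
  (X0 : {fset 'cV[R]_2}) (hX0 : X0 != fset0)
  (z : 'cV[R]_2) :
  let X := (z |` X0)%fset in
  let N := #|` X|%fset in
  terminates v1 v2 X z /\
  (forall K : nat, output v1 v2 X z K ->
    lower_cone_df v1 v2 X0 z =
      if z \in X0 then K%:R / N%:R else (K%:R - 1) / (N%:R - 1)).
Proof.
move=> X N; have zX : z \in X by rewrite !inE eqxx.
have g := free_generic hv.
split; first exact: algorithm_terminates.
have v12 : v1 <> v2.
  move: hv; rewrite free_cons span_seq1 => /andP[v1v2 _] e.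
  by rewrite e memv_line in v1v2.
move=> K /(output_min zX g v12) [[w wB wK] Kmin].
have minE : (ex_minn (wdepth_Bplus_ex v1 v2 X0 z) + (z \notin X0))%N = K.
  case: ex_minnP => m /asboolP[w' w'B w'm] mmin; apply/eqP; rewrite eqn_leq.
  rewrite -{2}w'm -wdepth_fset1U Kmin // andbT -wK wdepth_fset1U leq_add2r.
  by apply: mmin; apply/asboolP; exists w.
rewrite /lower_cone_df; move: minE; rewrite /N /X cardfsU1.
case: (z \in X0) => /= [|<-]; first by rewrite addn0 add0n => ->.
by rewrite add1n addn1 !mulrSr !addrK.
Qed.
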